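(* For every integer $n\ge 1$, the map $\Phi:\mathcal S_{1,n}\to\mathcal C_n$ (from decompositions of $(0,1)$ into $n$ intervals obtained by splitting operations, to natural exact covering systems of $\mathbb Z$ with $n$ residue classes), defined recursively in the context, is a bijection.
   Context: Decompositions of $(0,1)$: for an open interval $R=(a,b)\subseteq(0,1)$ and $p\ge2$, let $H_{1,p}(R)$ be the set of the $p$ open intervals $(a+\frac{j-1}{p}(b-a),\,a+\frac{j}{p}(b-a))$, $1\le j\le p$. $\mathcal S_1$ is the smallest set such that $\{(0,1)\}\in\mathcal S_1$ and, whenever $S\in\mathcal S_1$, $R\in S$, $p\ge2$, also $(S\setminus\{R\})\cup H_{1,p}(R)\in\mathcal S_1$ (a splitting operation). $\mathcal S_{1,n}=\{S\in\mathcal S_1:|S|=n\}$. For $r\ge1$ let $D_{(r)}=\{(\frac{j}{r},\frac{j+1}{r}):0\le j\le r-1\}$. Write $S'\succeq S$ if $S'$ can be obtained from $S$ by a (possibly empty) sequence of splitting operations. For $S\in\mathcal S_1$, $\gcd(S)=r$ means $S\succeq D_{(r)}$ and there is no $r'>r$ with $S\succeq D_{(r')}$. Natural exact covering systems (NECS): $\langle a,n\rangle=\{x\in\mathbb Z:x\equiv a \bmod n\}$. For $r\ge1$ and $i\in\{0,\dots,r-1\}$ let $E_{i,r}(\langle a,n\rangle)=\langle in+a,\,rn\rangle$. The set $\mathcal C$ of NECS is the smallest set such that $\{\langle0,1\rangle\}\in\mathcal C$ and, whenever $C\in\mathcal C$, $\langle a,n\rangle\in C$, $r\ge2$, also $(C\setminus\{\langle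 a,n\rangle\})\cup\{E_{i,r}(\langle a,n\rangle):0\le i\le r-1\}\in\mathcal C$. $\mathcal C_n$ is the set of $C\in\mathcal C$ with exactly $n$ residue classes. The map $\Phi$: for $n=1$, $\Phi(\{(0,1)\})=\{\langle0,1\rangle\}$. For $n\ge2$ and $S\in\mathcal S_{1,n}$, let $r=\gcd(S)$ and $B_j=(\frac jr,\frac{j+1}r)$ for $0\le j\le r-1$. When $E_{j,r}$ is applied to a residue class $T=\langle a,m\rangle$ in an NECS, the formula $E_{j,r}(\langle a,m\rangle)=\langle jm+a,rm\rangle$ is applied with the representative $a$ produced by the recursive construction (equivalently $0\le a<m$). Every interval of $S$ lies in a unique $B_j$. Let $S_j=\{\operatorname{scale}_{B_j\to(0,1)}(R):R\in S,\ R\subseteq B_j\}\in\mathcal S_1$, where $\operatorname{scale}_{B_j\to(0,1)}$ is the image under the increasing affine bijection from $B_j$ onto $(0,1)$, namely $x\mapsto rx-j$. Then $$\Phi(S)=\bigcup_{j=0}^{r-1}\{E_{j,r}(T):T\in\Phi(S_j)\}.$$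
   Formalization: The printed recursion for Φ does not land in C_n (it fails at {(0,1/2),(1/2,3/4),(3/4,1)}), so the formal Φ sends each T=⟨a,m⟩ in Φ(S_j) to ⟨ra+j, rm⟩ = E_{a,m}(⟨j,r⟩) instead of E_{j,r}(T)=⟨jm+a, rm⟩. *)

(* Defs.v *)
From HB Require Import structures.
From mathcomp Require Import all_boot all_order all_algebra finmap.
From mathcomp Require Import boolp classical_sets functions reals set_interval.

Set Implicit Arguments.
Unset Strict Implicit.
Unset Printing Implicit Defensive.

Import Order.TTheory GRing.Theory Num.Theory.
Local Open Scope classical_set_scope.
Local Open Scope fset_scope.
Local Open Scope ring_scope.

Section Decompositions.
Variable R : realType.
Implicit Types (S : {fset set R}) (a b : R).

Definition oo a b : set R := `]a, b[%classic.

Definition H1 (p : nat) a b : {fset set R} :=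
  [fset oo (a + j%:R / p%:R * (b - a)) (a + j.+1%:R / p%:R * (b - a))
     | j in iota 0 p].

(* [refines S0 S] is S ⪰ S0. *)
Inductive refines (S0 : {fset set R}) : {fset set R} -> Prop :=
| refines_refl : refines S0 S0
| refines_split S a b p :
    refines S0 S -> a < b -> oo a b \in S -> (2 <= p)%N ->
    refines S0 ((S `\ oo a b) `|` H1 p a b).

Definition decomposition S : Prop := refines [fset oo 0 1] S.

Definition D (r : nat) : {fset set R} :=
  [fset oo (j%:R / r%:R) (j.+1%:R / r%:R) | j in iota 0 r].

Definition is_gcd S (r : nat) : Prop :=
  [/\ (1 <= r)%N, refines (D r) S &
      forall r', (r < r')%N -> ~ refines (D r') S].

Definition gcdS S : nat := xget 0%N [set r | is_gcd S r].

(* The part of S inside B_j = (j/r, (j+1)/r), scaled to (0,1). *)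
Definition block S (r j : nat) : {fset set R} :=
  [fset [set r%:R * x - j%:R | x in I]%classic | I in S &
     `[< (I `<=` oo (j%:R / r%:R) (j.+1%:R / r%:R))%classic >]].

End Decompositions.

Definition residue_class (a : int) (n : nat) : set int :=
  [set x | (x = a %[mod n%:Z])%Z].

(* For n > 0 the set of all [E i r a n], i < r, depends only on the class of a
   modulo n, so [necs_split] may use any representative. *)
Definition E (i r : nat) (a : int) (n : nat) : set int :=
  residue_class (i%:Z * n%:Z + a) (r * n).

Inductive necs : {fset set int} -> Prop :=
| necs1 : necs [fset residue_class 0 1]
| necs_split C a n r :
    necs C -> (0 < n)%N -> residue_class a n \in C -> (2 <= r)%N ->
    necs ((C `\ residue_class a n) `|` [fset E i r a n | i in iota 0 r]).

(* The transport of a class T into the class of j modulo r, inverse to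
   "restrict to <j,r> and rescale".  On T = <a,m> it gives
   <r a + j, r m> = E_{a,m}(<j,r>), see [embedE].  The formula
   E_{j,r}(<a,m>) = <j m + a, r m> cannot be used here: it does not land in
   <j,r>, and for S = {(0,1/2),(1/2,3/4),(3/4,1)} it yields
   {<0,2>,<2,4>,<3,4>}, which is not a covering system. *)
Definition embed (j r : nat) (T : set int) : set int :=
  [set r%:Z * x + j%:Z | x in T]%classic.

Lemma embedE (j r a m : nat) : (0 < r)%N ->
  embed j r (residue_class a m) = E a m j r.
Proof.
move=> r0; have rz : r%:Z != 0 by rewrite -lt0n.
rewrite /embed /E /residue_class; apply/seteqP; split=> x /=.
  move=> [y /eqP yam <-]; apply/eqP; move: yam.
  rewrite !eqz_mod_dvd [_ * r%:Z]mulrC opprD addrACA subrr addr0 -mulrBr.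
  by rewrite PoszM [m%:Z * _]mulrC dvdz_mul2l.
move=> /eqP; rewrite eqz_mod_dvd PoszM => /dvdzP[q hq].
exists (q * m%:Z + a%:Z); first by rewrite modzMDl.
by rewrite -[x](subrK (a%:Z * r%:Z + j%:Z)) hq mulrC mulrDl addrA mulrA.
Qed.

(* The argument k is fuel: for decompositions of size >= 2, gcdS S >= 2 and each
   block is strictly smaller than S, so k = #|S| is enough. *)
Fixpoint Phi_rec (R : realType) (k : nat) (S : {fset set R}) : {fset set int} :=
  if k isn't k'.+1 then [fset residue_class 0 1] else
  if (#|` S| <= 1)%N then [fset residue_class 0 1] else
  let r := gcdS S in
  \bigcup_(j <- iota 0 r) [fset embed j r T | T in Phi_rec k' (block S r j)].

Definition Phi (R : realType) (S : {fset set R}) : {fset set int} :=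
  Phi_rec #|` S| S.

(* Main.v *)
(* Intervals and residue classes are handled by the same argument.  The cells
   of each system form one orbit x_{m,k} = act m k root, 0 <= k < m, where m is
   the modulus (the reciprocal length of an interval), and splitting x_{m,k}
   into p means applying act m k to the p cells x_{p,j}.  Call S glued from r
   blocks when it refines {x_{r,j} : j < r}.  If S is glued from r blocks and d
   divides all moduli of S, then d / gcd(d, r) divides all moduli of every
   block, so by induction the blocks are glued from d / gcd(d, r) blocks and S
   from lcm(d, r), hence from d.  Thus gcd(S) is the gcd of the moduli, and a
   nontrivial S has a unique normal form: glued from r = gcd(S) >= 2 smaller
   decompositions.  Phi copies this normal form from one system to the other;
   it preserves the gcd of the moduli, since the moduli of a glued S are r
   times those of the blocks, so copying back is its inverse. *)
Require Import Defs.
From mathcomp Require Import all_boot all_order all_algebra finmap.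
From mathcomp Require Import boolp classical_sets functions reals.
From mathcomp Require Import set_interval zify ring lra.

Set Implicit Arguments.
Unset Strict Implicit.
Unset Printing Implicit Defensive.

Import Order.TTheory GRing.Theory Num.Theory.
Local Open Scope classical_set_scope.
Local Open Scope fset_scope.

(* idx r j m k is the index of the k-th of m subcells of the j-th of r cells
   among r * m cells; it is here that intervals (k + j m) and residue classes
   (r k + j) differ. *)
Record splitting_system := SplittingSystem {
  cell :> choiceType;
  root : cell;
  act : nat -> nat -> cell -> cell;
  idx : nat -> nat -> nat -> nat -> nat;
  unidx : nat -> nat -> nat -> nat * nat;
  act_inj : forall r j, (0 < r)%N -> injective (act r j);
  act1 : forall x, act 1 0 x = x;
  actM : forall r j m k x, (0 < r)%N -> (0 < m)%N ->
    act r j (act m k x) = act (r * m) (idx r j m k) x;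
  act_root_inj : forall m k m' k', (k < m)%N -> (k' < m')%N ->
    act m k root = act m' k' root -> m = m' /\ k = k';
  idx_lt : forall r j m k, (j < r)%N -> (k < m)%N -> (idx r j m k < r * m)%N;
  idxK : forall r j m k, (j < r)%N -> (k < m)%N ->
    unidx r m (idx r j m k) = (j, k);
  unidxP : forall r m l, (l < r * m)%N ->
    [/\ ((unidx r m l).1 < r)%N, ((unidx r m l).2 < m)%N &
        idx r (unidx r m l).1 m (unidx r m l).2 = l] }.

Arguments act {s}.
Arguments root {s}.
Arguments idx {s}.
Arguments unidx {s}.

(** * Abstract splitting systems: cells, gluing and cardinality *)

Section Splitting.
Variable X : splitting_system.
Implicit Types (S : {fset X}) (x y : X) (F G : nat -> {fset X}).

Definition fan (p : nat) : {fset X} := [fset act p j root | j in iota 0 p].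

Definition glue (r : nat) F : {fset X} :=
  \bigcup_(j <- iota 0 r) [fset act r j x | x in F j].

Definition split_cell S (m k p : nat) : {fset X} :=
  (S `\ act m k root) `|` [fset act m k x | x in fan p].

Inductive refine (S0 : {fset X}) : {fset X} -> Prop :=
| refine_refl : refine S0 S0
| refine_split S m k p : refine S0 S -> (k < m)%N -> act m k root \in S ->
    (2 <= p)%N -> refine S0 (split_cell S m k p).

(** Generated by gluing instead of splitting, so that induction yields the blocks of a
    decomposition; [dec_refine] recovers the description by splittings. *)
Inductive dec : {fset X} -> Prop :=
| dec_root : dec [fset root]
| dec_glue r F : (2 <= r)%N -> (forall j, (j < r)%N -> dec (F j)) ->
    dec (glue r F).

Definition is_cell x := exists m k, (k < m)%N /\ x = act m k root.

Definition cells S := forall x, x \in S -> is_cell x.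

Definition moduli_div (d : nat) S :=
  forall m k, (k < m)%N -> act m k root \in S -> (d %| m)%N.

(** A maximum, to match the shape of [is_gcd] once refinement of [D r] is read as divisibility. *)
Definition moduli_gcd (r : nat) S :=
  moduli_div r S /\ forall r', (r < r')%N -> ~ moduli_div r' S.

Lemma fanP p x :
  reflect (exists2 j, (j < p)%N & x = act p j root) (x \in fan p).
Proof.
apply: (iffP (imfsetP _ _ _ _)) => -[j jp ->]; exists j => //;
by move: jp; rewrite ?mem_iota.
Qed.

Lemma glueP r F x :
  reflect (exists j y, [/\ (j < r)%N, y \in F j & x = act r j y])
          (x \in glue r F).
Proof.
apply: (iffP (bigfcupP _ _ _ _)).
  move=> [j]; rewrite mem_iota andbT => jr /imfsetP[y yF ->].
  by exists j, y.
move=> [j [y [jr yF ->]]]; exists j; first by rewrite mem_iota jr.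
by apply/imfsetP; exists y.
Qed.

Lemma eq_glue r F G : (forall j, (j < r)%N -> F j = G j) ->
  glue r F = glue r G.
Proof.
move=> FG; apply: eq_big_seq => j; rewrite mem_iota => /FG -> //.
Qed.

Lemma root_cell : is_cell (root : X).
Proof. by exists 1%N, 0%N; rewrite act1. Qed.

Lemma act_cell r j x : (j < r)%N -> is_cell x -> is_cell (act r j x).
Proof.
move=> jr [m [k [km ->]]]; exists (r * m)%N, (idx (s := X) r j m k).
by rewrite idx_lt // actM //; lia.
Qed.

(** Both sides are orbit cells, so their moduli and composed indices agree, and [unidx] reads off
    the block number. *)
Lemma act_cell_inj r j j' x x' : (j < r)%N -> (j' < r)%N ->
  is_cell x -> is_cell x' -> act r j x = act r j' x' -> j = j' /\ x = x'.
Proof.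
move=> jr jr' cx cx' e.
suff jj : j = j' by split=> //; move: e; rewrite jj; apply: act_inj; lia.
move: cx cx' e => [m [k [km ->]]] [m' [k' [km' ->]]].
have r0 : (0 < r)%N by lia.
rewrite !actM; [|lia..] => /act_root_inj[]; rewrite ?idx_lt // => /eqP.
rewrite eqn_pmul2l // => /eqP mm; move: km'; rewrite -mm => km' e.
by have := idxK X jr km; rewrite e idxK // => -[].
Qed.

Lemma cells_glue r F : (forall j, (j < r)%N -> cells (F j)) ->
  cells (glue r F).
Proof.
move=> cF x /glueP[j [y [jr yF ->]]].
by apply: act_cell => //; exact: (cF j).
Qed.

Lemma cells_root : cells [fset root].
Proof. by move=> x; rewrite in_fset1 => /eqP ->; exact: root_cell. Qed.

Lemma cells_fan r : cells (fan r).
Proof. by move=> x /fanP[j jr ->]; apply: act_cell => //; exact: root_cell. Qed.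

Lemma cells_split S m k p : (k < m)%N -> cells S -> cells (split_cell S m k p).
Proof.
move=> km cS x; rewrite inE => /orP[]; first by rewrite in_fsetD => /andP[_ /cS].
by move=> /imfsetP[y /cells_fan cy ->]; apply: act_cell.
Qed.

Lemma cells_refine S0 S : cells S0 -> refine S0 S -> cells S.
Proof. by move=> cS0; elim=> // {}S m k p _ cS km _ _; apply: cells_split. Qed.

Lemma dec_cells S : dec S -> cells S.
Proof.
by elim=> [|r F _ _ IH]; [exact: cells_root | exact: cells_glue].
Qed.

Lemma fan_glue r : fan r = glue r (fun=> [fset root]).
Proof.
apply/fsetP => x; apply/fanP/glueP => [[j jr ->]|[j [y []]]].
  by exists j, root; rewrite in_fset1.
by rewrite in_fset1 => jr /eqP -> ->; exists j.
Qed.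

Lemma glue1 F : glue 1 F = F 0%N.
Proof.
apply/fsetP => x; apply/glueP/idP => [[[|j] [y [//]]]|xF].
  by rewrite act1 => _ yF ->.
by exists 0%N, x; rewrite act1.
Qed.

(** A number below [r * s] corresponds through [unidx] to a pair of numbers below [r] and [s], so
    blocks can be regrouped in two levels. *)
Lemma glueM r s F : glue (r * s) F =
  glue r (fun j => glue s (fun k => F (idx (s := X) r j s k))).
Proof.
apply/fsetP => x; apply/glueP/glueP => [[l [y [lrs yF ->]]]|].
  have [jr ks e] := unidxP X lrs.
  set j := (unidx r s l).1 in jr e; set k := (unidx r s l).2 in ks e.
  exists j, (act s k y); split=> //; last by rewrite actM ?e //; lia.
  by apply/glueP; exists k, y; rewrite e.
move=> [j [y [jr /glueP[k [z [ks zF ->]]] ->]]].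
by exists (idx (s := X) r j s k), z; rewrite idx_lt // actM //; lia.
Qed.

Lemma glue_glue r s (F : nat -> nat -> {fset X}) :
  glue r (fun j => glue s (F j)) =
  glue (r * s) (fun l => F (unidx (s := X) r s l).1 (unidx (s := X) r s l).2).
Proof.
rewrite glueM; apply: eq_glue => j jr; apply: eq_glue => k ks.
by rewrite idxK.
Qed.

(** By [act_cell_inj], a cell of a gluing determines its block and its preimage there. *)
Lemma glue_inj r F G : (forall j, (j < r)%N -> cells (F j)) ->
  (forall j, (j < r)%N -> cells (G j)) -> glue r F = glue r G ->
  forall j, (j < r)%N -> F j = G j.
Proof.
suff sub F' G' : (forall j, (j < r)%N -> cells (F' j)) ->
    (forall j, (j < r)%N -> cells (G' j)) -> glue r F' = glue r G' ->
    forall j, (j < r)%N -> F' j `<=` G' j.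
  by move=> cF cG e j jr; apply/eqP; rewrite eqEfsubset !sub.
move=> cF cG e j jr; apply/fsubsetP => x xF.
have : act r j x \in glue r F' by apply/glueP; exists j, x.
rewrite e => /glueP[i [y [ir yG]]].
by move=> /act_cell_inj[]//; [exact: (cF j)|exact: (cG i)|move=> -> ->].
Qed.

Lemma card_glue r F : (forall j, (j < r)%N -> cells (F j)) ->
  #|` glue r F| = (\sum_(j <- iota 0 r) #|` F j|)%N.
Proof.
move=> cF; rewrite /glue.
have : uniq (iota 0 r) by exact: iota_uniq.
have : {subset iota 0 r <= iota 0 r} by [].
(* The list of block numbers is generalised to a duplicate-free one whose entries are still known to
   be below [r]. *)
elim: {1 3 4 5}(iota 0 r) => [|j s IH] sub /=; first by rewrite !big_nil cardfs0.
move=> /andP[js us]; rewrite !big_cons.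
have jr : (j < r)%N by have := sub j (mem_head _ _); rewrite mem_iota.
rewrite -IH //; last by move=> i si; apply: sub; rewrite inE si orbT.
rewrite cardfsU card_imfset /=; last by apply: act_inj; lia.
set I := _ `&` _; suff -> : I = fset0 by rewrite cardfs0 subn0.
apply/fsetP => x; rewrite in_fset0; apply/negP; rewrite in_fsetI => /andP[].
move=> /imfsetP[y yF ->] /bigfcupP[i /andP[si _] /imfsetP[z zF]].
have ir : (i < r)%N.
  by have := sub i; rewrite mem_iota inE si orbT; apply.
move=> /act_cell_inj[]//; [exact: (cF j)|exact: (cF i)|].
by move=> ji; rewrite ji si in js.
Qed.

Lemma dec_gt0 S : dec S -> (0 < #|` S|)%N.
Proof.
elim=> [|r F r2 dF IH]; first by rewrite cardfs1.
rewrite card_glue; last by move=> j /dF /dec_cells.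
case: r r2 dF IH => // r _ _ IH /=.
by rewrite big_cons; have := IH 0%N isT; lia.
Qed.

Lemma card_glue_lt r F j : (2 <= r)%N -> (forall j, (j < r)%N -> dec (F j)) ->
  (j < r)%N -> (#|` F j| < #|` glue r F|)%N.
Proof.
move=> r2 dF jr; rewrite card_glue; last by move=> i /dF /dec_cells.
rewrite (bigD1_seq j) /= ?iota_uniq ?mem_iota //.
(* Since [2 <= r] there is a second block, and it contributes at least one cell. *)
have [i ij ir] : exists2 i, i != j & (i < r)%N.
  by case: j jr => [|j] jr; [exists 1%N | exists 0%N => //; lia].
rewrite (big_rem i) /= ?mem_iota // ij.
have := dec_gt0 (dF i ir); lia.
Qed.

(** * Splitting inside a gluing, and refinement expressed by gluing *)

Definition upd F (j : nat) S := fun i => if i == j then S else F i.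

(** Distinct blocks share no cells, so removing a cell of block [j] leaves the others untouched;
    [actM] identifies the new subcells. *)
Lemma split_glue r F j m k p : (forall i, (i < r)%N -> cells (F i)) ->
  (j < r)%N -> (k < m)%N ->
  split_cell (glue r F) (r * m) (idx (s := X) r j m k) p =
  glue r (upd F j (split_cell (F j) m k p)).
Proof.
move=> cF jr km; have r0 : (0 < r)%N by lia.
have m0 : (0 < m)%N by lia.
apply/fsetP => x; rewrite inE in_fsetD1 -actM //; apply/idP/glueP.
  move=> /orP[/andP[xn /glueP[i [y [ir yF xE]]]]|/imfsetP[y yf ->]].
    exists i, y; split=> //; rewrite /upd; case: eqVneq => // ij.
    rewrite inE in_fsetD1 -ij yF andbT.
    by apply/orP; left; apply: contra xn => /eqP <-; rewrite xE ij.
  exists j, (act m k y); split=> //; last by rewrite actM.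
  by rewrite /upd eqxx inE; apply/orP; right; apply/imfsetP; exists y.
move=> [i [y [ir]]]; rewrite /upd; case: eqVneq => [->|ij].
  rewrite inE in_fsetD1 => /orP[/andP[yn yF] ->|/imfsetP[z zf ->] ->].
    apply/orP; left; apply/andP; split; last by apply/glueP; exists j, y.
    by apply: contra yn => /eqP/act_inj ->.
  by apply/orP; right; apply/imfsetP; exists z => //; rewrite actM.
move=> yF ->; apply/orP; left; apply/andP; split; last by apply/glueP; exists i, y.
apply: contra ij => /eqP /act_cell_inj[]//; first exact: (cF i).
  by apply: act_cell => //; exact: root_cell.
by move=> ->.
Qed.

Lemma mem_glue_root r F m k : (forall i, (i < r)%N -> cells (F i)) ->
  (k < m)%N -> act m k root \in glue r F ->
  exists j m' k', [/\ (j < r)%N, (k' < m')%N, act m' k' root \in F j,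
    m = (r * m')%N & k = idx (s := X) r j m' k'].
Proof.
move=> cF km /glueP[j [y [jr yF]]].
have [m' [k' [km' yE]]] := cF j jr y yF.
rewrite yE actM; [|lia..] => /act_root_inj[]//; first exact: idx_lt.
by move=> -> ->; exists j, m', k'; rewrite -yE.
Qed.

Lemma mem_root m k : (k < m)%N -> (act m k root : X) \in [fset root] ->
  m = 1%N /\ k = 0%N.
Proof.
by move=> km; rewrite in_fset1 -[X in _ == X]act1 => /eqP /act_root_inj[].
Qed.

Lemma split_root p : split_cell [fset root] 1 0 p = fan p.
Proof.
apply/fsetP => x; rewrite /split_cell act1 fsetDv fset0U.
by apply/imfsetP/idP => [[y yf ->]|xf]; [rewrite act1|exists x; rewrite ?act1].
Qed.

(** Splitting the root gives a fan, that is, a gluing of roots; in a gluing the split happens inside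
    one block, where the induction hypothesis applies. *)
Lemma dec_split S m k p : dec S -> (k < m)%N -> act m k root \in S ->
  (2 <= p)%N -> dec (split_cell S m k p).
Proof.
move=> dS km mS p2; elim: dS m k km mS => [|r F r2 dF IH] m k km.
  move=> /(mem_root km)[-> ->]; rewrite split_root fan_glue.
  by apply: dec_glue => // *; exact: dec_root.
have cF i : (i < r)%N -> cells (F i) by move=> /dF /dec_cells.
move=> /(mem_glue_root cF km)[j [m' [k' [jr km' yF -> ->]]]].
rewrite split_glue //; apply: dec_glue => // i ir.
by rewrite /upd; case: eqVneq => // _; [exact: IH|exact: dF].
Qed.

Lemma refine_trans S0 S1 S2 : refine S0 S1 -> refine S1 S2 -> refine S0 S2.
Proof. by move=> r01; elim=> // S m k p _ r0 *; exact: refine_split. Qed.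

Lemma refine_glue r F j S : (forall i, (i < r)%N -> cells (F i)) ->
  (j < r)%N -> refine (F j) S -> refine (glue r F) (glue r (upd F j S)).
Proof.
move=> cF jr; elim=> [|{}S m k p rS IH km mS p2].
  rewrite [X in refine _ X](@eq_glue r _ F); first exact: refine_refl.
  by move=> i _; rewrite /upd; case: eqVneq => // ->.
have cS : cells S by apply: cells_refine rS; exact: cF.
have cU i : (i < r)%N -> cells (upd F j S i).
  by rewrite /upd; case: eqVneq => // _ /cF.
have := @split_glue r (upd F j S) j m k p cU jr km.
rewrite [RHS](@eq_glue r _ (upd F j (split_cell S m k p))); last first.
  by move=> i _; rewrite /upd; case: eqVneq => // _; rewrite eqxx.
move=> <-; apply: refine_split => //; first exact: idx_lt.
rewrite -actM; [|lia..]; apply/glueP; exists j, (act m k root).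
by rewrite /upd eqxx.
Qed.

Lemma refine_fan_glue r F : (0 < r)%N ->
  (forall j, (j < r)%N -> refine [fset root] (F j)) ->
  refine (fan r) (glue r F).
Proof.
move=> r0 rF.
(* Blocks are refined one at a time: in [H n] the first [n] are finished and the others are still
   the root. *)
pose H n i := if (i < n)%N then F i else [fset root].
suff Hn n : (n <= r)%N -> refine (fan r) (glue r (H n)).
  have := Hn r (leqnn r); rewrite (@eq_glue r _ F) // /H.
  by move=> j ->.
elim: n => [|n IH] nr; first by rewrite fan_glue; exact: refine_refl.
apply: refine_trans (IH (ltnW nr)) _.
rewrite (@eq_glue r (H n.+1) (upd (H n) n (F n))).
  apply: refine_glue => //; last by rewrite /H ltnn; exact: rF.
  move=> i ir; rewrite /H; case: ifP => _; last exact: cells_root.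
  by apply: cells_refine (rF i ir); exact: cells_root.
move=> i _; rewrite /upd /H ltnS leq_eqVlt.
by case: eqVneq => // ->.
Qed.

Lemma dec_refine S : dec S <-> refine [fset root] S.
Proof.
split.
  elim=> [|r F r2 _ IH]; first exact: refine_refl.
  apply: refine_trans (refine_fan_glue (ltnW r2) IH).
  rewrite -split_root; apply: refine_split => //; first exact: refine_refl.
  by rewrite act1 in_fset1.
elim=> [|{}S m k p _ dS km mS p2]; first exact: dec_root.
exact: dec_split.
Qed.

(** Each split alters a single block and keeps it a decomposition, so the [r] blocks persist along
    the refinement. *)
Lemma refine_fanP r S : (0 < r)%N -> refine (fan r) S <->
  exists2 F, (forall j, (j < r)%N -> dec (F j)) & S = glue r F.
Proof.
move=> r0; split; last first.
  by move=> [F dF ->]; apply: refine_fan_glue => // j /dF /dec_refine.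
elim=> [|{}S m k p _ [F dF ->] km mS p2].
  by exists (fun=> [fset root]); [move=> *; exact: dec_root|exact: fan_glue].
have cF i : (i < r)%N -> cells (F i) by move=> /dF /dec_cells.
have [j [m' [k' [jr km' yF -> ->]]]] := mem_glue_root cF km mS.
rewrite split_glue //; eexists; last by [].
move=> i ir; rewrite /upd; case: eqVneq => [_|_]; last exact: dF.
by apply: dec_split => //; exact: dF.
Qed.

Lemma dec_glue_gt0 r F : (0 < r)%N -> (forall j, (j < r)%N -> dec (F j)) ->
  dec (glue r F).
Proof.
case: r => [//|[|r]] _ dF; last exact: dec_glue.
by rewrite glue1; exact: dF.
Qed.

(** * Common divisors of the moduli and the normal form *)

(** With g = gcd(d, r), the right-hand side says that d divides m g = gcd(m d, m r), and d always
    divides m d. *)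
Lemma dvdn_mul_gcd d r m : (0 < d)%N -> (d %| r * m)%N = (d %/ gcdn d r %| m)%N.
Proof.
move=> d0; have g0 : (0 < gcdn d r)%N by rewrite gcdn_gt0 d0.
rewrite -[in RHS](dvdn_pmul2r g0) divnK ?dvdn_gcdl // muln_gcdr dvdn_gcd.
by rewrite [X in X && _]dvdn_mull //= mulnC.
Qed.

(** The moduli of a gluing are [r] times those of its blocks, so [dvdn_mul_gcd] applies to each of
    them. *)
Lemma moduli_div_glue d r F : (0 < d)%N -> (0 < r)%N ->
  (forall i, (i < r)%N -> cells (F i)) ->
  moduli_div d (glue r F) <->
  forall j, (j < r)%N -> moduli_div (d %/ gcdn d r) (F j).
Proof.
move=> d0 r0 cF; split=> [dF j jr m k km mF|dF m k km].
  rewrite -dvdn_mul_gcd //; apply: (dF _ (idx (s := X) r j m k)).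
    exact: idx_lt.
  rewrite -actM //; last by lia.
  by apply/glueP; exists j, (act m k root).
move=> /(mem_glue_root cF km)[j [m' [k' [jr km' yF -> _]]]].
by rewrite dvdn_mul_gcd //; exact: (dF j jr m' k').
Qed.

Lemma moduli_div_root d : moduli_div d [fset root] <-> d = 1%N.
Proof.
split=> [/(_ 1%N 0%N isT)|-> m k _ _]; last exact: dvd1n.
by rewrite act1 in_fset1 eqxx dvdn1 => /(_ isT)/eqP.
Qed.

(** A numerical condition produces a gluing from [d] blocks, although the last gluing step of [S]
    may use a different number [r]. *)
Lemma moduli_div_dec d S : (0 < d)%N -> dec S -> moduli_div d S <->
  exists2 F, (forall j, (j < d)%N -> dec (F j)) & S = glue d F.
Proof.
move=> d0 dS; split; last first.
  move=> [F dF ->]; apply/moduli_div_glue => //.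
    by move=> i /dF /dec_cells.
  by rewrite gcdnn divnn d0 => j _ m k _ _; exact: dvd1n.
elim: dS d d0 => [|r F r2 dF IH] d d0.
  move=> /moduli_div_root ->; exists (fun=> [fset root]); last by rewrite glue1.
  by move=> *; exact: dec_root.
have cF i : (i < r)%N -> cells (F i) by move=> /dF /dec_cells.
have r0 := ltnW r2.
move=> /(moduli_div_glue d0 r0 cF); set s := (d %/ gcdn d r)%N => sF.
have g0 : (0 < gcdn d r)%N by rewrite gcdn_gt0 d0.
have s0 : (0 < s)%N by rewrite divn_gt0 // dvdn_leq // dvdn_gcdl.
(* Every block is itself glued from [s] blocks; the value for [j >= r] is an arbitrary filler. *)
have /choice[G GP] : forall j, exists G : nat -> {fset X}, (j < r)%N ->
    (forall k, (k < s)%N -> dec (G k)) /\ F j = glue s G.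
  move=> j; case: (ltnP j r) => [jr|_]; last by exists F.
  by have [G dG e] := IH j jr s s0 (sF j jr); exists G.
rewrite (eq_glue (G := fun j => glue s (G j))); last by move=> j /GP[].
rewrite glue_glue; set H := (X in glue _ X).
have dH l : (l < r * s)%N -> dec (H l).
  by move=> /(unidxP X)[jr ks _]; apply: (GP _ jr).1.
(* Both sides are lcm(d, r): the [r * s] small blocks regroup into [d] groups of r / gcd(d, r). *)
have rsE : (r * s = d * (r %/ gcdn d r))%N.
  by rewrite /s muln_divA ?dvdn_gcdl // muln_divA ?dvdn_gcdr // mulnC.
have t0 : (0 < r %/ gcdn d r)%N by rewrite divn_gt0 // dvdn_leq // dvdn_gcdr.
rewrite rsE glueM; eexists; last by [].
move=> j jd; apply: dec_glue_gt0 => // k kt; apply: dH.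
by rewrite rsE; exact: idx_lt.
Qed.

Lemma moduli_gcd_uniq r r' S : moduli_gcd r S -> moduli_gcd r' S -> r = r'.
Proof.
move=> [dr gr] [dr' gr']; case: (ltngtP r r') => // [/gr|/gr'] //.
Qed.

(** The modulus of any cell bounds the common divisors, so a greatest one exists; it is at least 2
    because [S], not being the root alone, is a gluing. *)
Lemma dec_normal S : dec S -> (2 <= #|` S|)%N ->
  exists r F, [/\ (2 <= r)%N, forall j, (j < r)%N -> dec (F j),
    moduli_gcd r S & S = glue r F].
Proof.
move=> dS S2.
have [r0 r02 dr0] : exists2 r, (2 <= r)%N & moduli_div r S.
  case: dS S2 => [|r F r2 dF _]; first by rewrite cardfs1.
  exists r => //; apply/(moduli_div_dec (ltnW r2)); first exact: dec_glue.
  by exists F.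
have [x xS] : exists x, x \in S.
  by apply/fset0Pn; rewrite -cardfs_gt0; lia.
have [m [k [km xE]]] := dec_cells dS xS.
have ub r : `[< moduli_div r S >] -> (r <= m)%N.
  move=> /asboolP dr; apply: dvdn_leq; first by lia.
  by apply: (dr m k); rewrite -?xE.
have ex : exists r, `[< moduli_div r S >] by exists r0; exact/asboolP.
have [r /asboolP dr rmax] := ex_maxnP ex ub.
have r2 : (2 <= r)%N by apply: leq_trans r02 _; apply: rmax; exact/asboolP.
have [F dF e] := (moduli_div_dec (ltnW r2) dS).1 dr.
exists r, F; split=> //; split=> // r' rr' /asboolP/rmax; lia.
Qed.

Lemma dec_card1 S : dec S -> (#|` S| <= 1)%N -> S = [fset root].
Proof.
case=> // r F r2 dF; have := card_glue_lt r2 dF (ltnW r2).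
have := dec_gt0 (dF 0%N (ltnW r2)); lia.
Qed.

End Splitting.

Arguments dec {X}.
Arguments refine {X}.

(* The graph of Phi; the condition on r mentions only the left-hand side, and
   corr_moduli is what makes the relation symmetric. *)
Inductive corr (X Y : splitting_system) : {fset X} -> {fset Y} -> Prop :=
| corr_root : corr [fset root] [fset root]
| corr_glue r F G : (2 <= r)%N -> moduli_gcd r (glue r F) ->
    (forall j, (j < r)%N -> corr (F j) (G j)) ->
    corr (glue r F) (glue r G).

(** * The correspondence is symmetric, functional and total *)

Section Correspondence.
Variables X Y : splitting_system.
Implicit Types (S : {fset X}) (C : {fset Y}).

Lemma corr_decl S C : corr S C -> dec S.
Proof.
by elim=> [|r F G r2 _ _ IH]; [exact: dec_root|exact: dec_glue].
Qed.

Lemma corr_decr S C : corr S C -> dec C.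
Proof.
by elim=> [|r F G r2 _ _ IH]; [exact: dec_root|exact: dec_glue].
Qed.

Lemma corr_card S C : corr S C -> #|` S| = #|` C|.
Proof.
elim=> [|r F G r2 _ FG IH]; first by rewrite !cardfs1.
rewrite !card_glue => [|j /FG /corr_decr/dec_cells//|j /FG /corr_decl/dec_cells//].
by apply: eq_big_seq => j; rewrite mem_iota => /IH.
Qed.

(** The criterion of [moduli_div_glue] does not mention [idx], so it reads the same on both sides;
    the induction is over all [d] because the blocks need another divisor. *)
Lemma corr_moduli S C d : corr S C -> (0 < d)%N ->
  moduli_div d S <-> moduli_div d C.
Proof.
move=> SC; elim: SC d => [|r F G r2 _ FG IH] d d0.
  by rewrite !moduli_div_root.
have r0 := ltnW r2.
rewrite !moduli_div_glue // => [|j /FG /corr_decr/dec_cells//|j /FG /corr_decl/dec_cells//].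
have s0 : (0 < d %/ gcdn d r)%N.
  by rewrite divn_gt0 ?gcdn_gt0 ?d0 // dvdn_leq // dvdn_gcdl.
by split=> h j jr; apply/(IH j jr _ s0); exact: h.
Qed.

Lemma corr_sym S C : corr S C -> corr C S.
Proof.
elim=> [|r F G r2 gr FG IH]; first exact: corr_root.
apply: corr_glue => //; have SC := corr_glue r2 gr FG.
have [dr mr] := gr; split; first by apply/(corr_moduli SC) => //; lia.
move=> r' rr' /(corr_moduli SC) h; apply: (mr r' rr'); apply: h; lia.
Qed.

(** Uniqueness of the normal form: the gcd of the moduli fixes [r], and [glue_inj] fixes the
    blocks. *)
Lemma corr_fun S C C' : corr S C -> corr S C' -> C = C'.
Proof.
move=> SC SC'; elim: SC C' SC' => [|r F G r2 gr FG IH] C' SC'.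
  (* The singleton becomes a variable of cardinality 1 so that [SC'] can be analysed; a gluing has
     at least two cells. *)
  move: (fset1 _) SC' (cardfs1 (root : X)) => S0; case=> // r F G r2 _ FG.
  have dF j : (j < r)%N -> dec (F j) by move=> /FG /corr_decl.
  have := card_glue_lt r2 dF (ltnW r2); have := dec_gt0 (dF 0%N (ltnW r2)); lia.
have dF j : (j < r)%N -> dec (F j) by move=> /FG /corr_decl.
move: SC' gr; move e : (glue r F) => S0 SC'.
case: SC' e => [e|r' F' G' r2' gr' FG' e gr].
  have := card_glue_lt r2 dF (ltnW r2); have := dec_gt0 (dF 0%N (ltnW r2)).
  by rewrite e cardfs1; lia.
have rr := moduli_gcd_uniq gr gr'; move: e FG'; rewrite -rr => e FG'.
apply: eq_glue => j jr; apply: IH => //.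
have -> : F j = F' j; last exact: FG'.
apply: glue_inj e j jr => j jr; first exact/dec_cells/dF.
exact/dec_cells/(corr_decl (FG' j jr)).
Qed.

Lemma corr_total S : dec S -> exists C, corr S C.
Proof.
move: {2}#|` S| (leqnn #|` S|) => n; elim: n S => [|n IH] S Sn dS.
  by have := dec_gt0 dS; lia.
have [S1|S2] := leqP #|` S| 1%N.
  by rewrite (dec_card1 dS S1); exists [fset root]; exact: corr_root.
have [r [F [r2 dF gr SE]]] := dec_normal dS S2.
have /choice[G GP] : forall j, exists C, (j < r)%N -> corr (F j) C.
  move=> j; case: (ltnP j r) => [jr|_]; last by exists fset0.
  have [|C FC] := IH (F j) _ (dF j jr); last by exists C.
  have := card_glue_lt r2 dF jr; rewrite -SE; lia.
by exists (glue r G); rewrite SE; apply: corr_glue => //; rewrite -SE.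
Qed.

End Correspondence.

Local Open Scope ring_scope.

(** * Residue classes as a splitting system *)

Lemma image_set_inj (T T' : Type) (f : T -> T') : injective f ->
  injective (fun A : set T => [set f x | x in A]%classic).
Proof.
move=> fI A B AB; apply/funext => x.
by rewrite -(image_inj fI (A := A)) AB (image_inj fI).
Qed.

(** The class of [c] modulo [p] contains [c] and [c + p]; if it is also a class modulo [q], then [q]
    divides their difference [p]. Exchanging the roles makes the moduli equal. *)
Lemma residue_class_inj (a b : int) (m n : nat) : (0 < m)%N -> (0 < n)%N ->
  residue_class a m = residue_class b n -> m = n /\ (a = b %[mod n%:Z])%Z.
Proof.
suff dv c d (p q : nat) : (0 < p)%N -> (0 < q)%N ->
    residue_class c p = residue_class d q ->
    (q %| p)%N /\ (c = d %[mod q%:Z])%Z.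
  move=> m0 n0 e; have [nm ab] := dv _ _ _ _ m0 n0 e.
  have [mn _] := dv _ _ _ _ n0 m0 (esym e); split=> //.
  by apply/eqP; rewrite eqn_dvd mn nm.
move=> p0 q0 e.
have cd : residue_class d q c by rewrite -e.
have : residue_class d q (c + p%:Z) by rewrite -e /residue_class /= modzDr.
rewrite /residue_class /= in cd *; rewrite -cd => /eqP.
by rewrite eqz_mod_dvd addrAC subrr add0r.
Qed.

Lemma eq_residue_class (a b : int) (n : nat) : (a = b %[mod n%:Z])%Z ->
  residue_class a n = residue_class b n.
Proof. by move=> e; rewrite /residue_class e. Qed.

Lemma embed_root (r j : nat) : (0 < r)%N ->
  embed j r (residue_class 0 1) = residue_class j%:Z r.
Proof.
by move=> r0; rewrite -[0]/(0%N%:Z) embedE // /E mul0r add0r mul1n.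
Qed.

Lemma embed_inj (r j : nat) : (0 < r)%N -> injective (embed j r).
Proof.
move=> r0; apply: image_set_inj => x y /addIr/mulfI; apply; lia.
Qed.

Lemma embed1 (T : set int) : embed 0 1 T = T.
Proof.
rewrite /embed -[RHS]image_id; apply: eq_imagel => x _ /=.
by rewrite mul1r addr0.
Qed.

Lemma embedM (r j m k : nat) (T : set int) : (0 < r)%N -> (0 < m)%N ->
  embed j r (embed k m T) = embed (r * k + j) (r * m) T.
Proof.
move=> _ _; rewrite /embed image_comp; apply: eq_imagel => x _ /=.
by rewrite PoszD !PoszM mulrDr mulrA addrA.
Qed.

Lemma embed_root_inj (m k m' k' : nat) : (k < m)%N -> (k' < m')%N ->
  embed k m (residue_class 0 1) = embed k' m' (residue_class 0 1) ->
  m = m' /\ k = k'.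
Proof.
move=> km km'; rewrite !embed_root; [|lia..].
move=> /residue_class_inj[]; [lia..|move=> mm]; rewrite -mm in km' *.
by rewrite !modz_small //; lia.
Qed.

Lemma residue_idx_lt (r j m k : nat) : (j < r)%N -> (k < m)%N ->
  (r * k + j < r * m)%N.
Proof. nia. Qed.

Lemma residue_idxK (r j m k : nat) : (j < r)%N -> (k < m)%N ->
  (((r * k + j) %% r)%N, ((r * k + j) %/ r)%N) = (j, k).
Proof.
move=> jr km; rewrite mulnC modnMDl modn_small // divnMDl ?divn_small ?addn0 //.
lia.
Qed.

Lemma residue_unidxP (r m l : nat) : (l < r * m)%N ->
  [/\ ((l %% r)%N, (l %/ r)%N).1 < r, ((l %% r)%N, (l %/ r)%N).2 < m &
      r * ((l %% r)%N, (l %/ r)%N).2 + ((l %% r)%N, (l %/ r)%N).1 = l]%N.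
Proof.
move=> lrm /=; have r0 : (0 < r)%N by lia.
rewrite ltn_pmod // ltn_divLR // [(m * r)%N]mulnC lrm.
by rewrite mulnC -divn_eq.
Qed.

(** The block number is the low digit of the index, its remainder modulo [r]. *)
Definition residues : splitting_system :=
  SplittingSystem (cell := set int) embed_inj embed1 embedM embed_root_inj
    residue_idx_lt residue_idxK residue_unidxP.

(** * Open intervals as a splitting system *)

Section IntervalSystem.
Variable R : realType.
Implicit Types (a b c d : R) (I : set R).

(** Otherwise a midpoint escapes: if a < c, the one between [a] and the smaller of [b] and [c] lies
    only in the first interval. The right end is symmetric. *)
Lemma oo_sub a b c d : a < b -> (oo a b `<=` oo c d)%classic -> c <= a /\ b <= d.
Proof.
move=> ab sub.
have {}sub x : a < x < b -> c < x < d.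
  by move=> xab; have := sub x; rewrite /oo /= !in_itv /=; exact.
split; rewrite leNgt; apply/negP => h.
  have [bc|cb] := leP b c.
    by have := sub ((a + b) / 2); lra.
  by have := sub ((a + c) / 2); lra.
have [da|ad] := leP d a.
  by have := sub ((a + b) / 2); lra.
by have := sub ((d + b) / 2); lra.
Qed.

Lemma oo_inj a b c d : a < b -> oo a b = oo c d -> a = c /\ b = d.
Proof.
move=> ab e; have [|ca bd] := @oo_sub a b c d ab; first by rewrite e.
have [] := @oo_sub c d a b _ _; [exact: le_lt_trans ca (lt_le_trans ab bd)|by rewrite e|].
by move=> ac db; split; apply/eqP; rewrite eq_le ?ca ?ac ?bd ?db.
Qed.

(** Inverse of the scaling x -> r x - j used in [block]. *)
Definition shrink (r j : nat) I : set R :=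
  [set (x + j%:R) / r%:R | x in I]%classic.

Lemma shrink_oo (r j : nat) a b : (0 < r)%N ->
  shrink r j (oo a b) = oo ((a + j%:R) / r%:R) ((b + j%:R) / r%:R).
Proof.
move=> r0; have rR : 0 < r%:R :> R by rewrite ltr0n.
apply/seteqP; split=> x; rewrite /oo /= !in_itv /=.
  move=> [y]; rewrite /= in_itv /= => /andP[ay yb] <-.
  by rewrite !ltr_pM2r ?invr_gt0 // !ltrD2r ay.
rewrite ltr_pdivrMr // ltr_pdivlMr // => xE.
exists (x * r%:R - j%:R); last by rewrite subrK mulfK ?gt_eqF.
by rewrite /= in_itv /= ltrBrDr ltrBlDr.
Qed.

Lemma shrink_root (r j : nat) : (0 < r)%N ->
  shrink r j (oo 0 1) = oo (j%:R / r%:R) (j.+1%:R / r%:R).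
Proof. by move=> r0; rewrite shrink_oo // add0r nat1r. Qed.

Lemma shrink_inj (r j : nat) : (0 < r)%N -> injective (shrink r j).
Proof.
move=> r0; apply: image_set_inj => x y /mulIf h; apply: (addIr j%:R); apply: h.
by rewrite invr_eq0 pnatr_eq0; lia.
Qed.

Lemma shrink1 I : shrink 1 0 I = I.
Proof.
rewrite /shrink -[RHS]image_id; apply: eq_imagel => x _ /=.
by rewrite divr1 addr0.
Qed.

Lemma shrinkM (r j m k : nat) I : (0 < r)%N -> (0 < m)%N ->
  shrink r j (shrink m k I) = shrink (r * m) (k + j * m) I.
Proof.
move=> r0 m0; rewrite /shrink image_comp; apply: eq_imagel => x _ /=.
rewrite natrD !natrM; field.
by rewrite !pnatr_eq0; apply/andP; split; lia.
Qed.

(** The length 1/m determines the modulus, and then the left end k/m determines the index. *)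
Lemma shrink_root_inj (m k m' k' : nat) : (k < m)%N -> (k' < m')%N ->
  shrink m k (oo 0 1) = shrink m' k' (oo 0 1) -> m = m' /\ k = k'.
Proof.
move=> km km'; rewrite !shrink_root; [|lia..].
have mR : 0 < m%:R :> R by rewrite ltr0n; lia.
have mR' : 0 < m'%:R :> R by rewrite ltr0n; lia.
move=> /oo_inj[]; first by rewrite ltr_pM2r ?invr_gt0 // ltr_nat.
move=> e1 e2.
have mm : m = m'.
  have : m%:R^-1 = m'%:R^-1 :> R.
    move: e2; rewrite -!nat1r !mulrDl e1 => /addIr; rewrite !mul1r; exact.
  by move/invr_inj/eqP; rewrite eqr_nat => /eqP.
split=> //; move: e1; rewrite -mm => /mulIf; rewrite invr_eq0 gt_eqF // => /(_ isT).
by move/eqP; rewrite eqr_nat => /eqP.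
Qed.

Lemma interval_idx_lt (r j m k : nat) : (j < r)%N -> (k < m)%N ->
  (k + j * m < r * m)%N.
Proof. nia. Qed.

Lemma interval_idxK (r j m k : nat) : (j < r)%N -> (k < m)%N ->
  (((k + j * m) %/ m)%N, ((k + j * m) %% m)%N) = (j, k).
Proof.
move=> jr km; rewrite addnC modnMDl modn_small // divnMDl ?divn_small ?addn0 //.
lia.
Qed.

Lemma interval_unidxP (r m l : nat) : (l < r * m)%N ->
  [/\ ((l %/ m)%N, (l %% m)%N).1 < r, ((l %/ m)%N, (l %% m)%N).2 < m &
      ((l %/ m)%N, (l %% m)%N).2 + ((l %/ m)%N, (l %% m)%N).1 * m = l]%N.
Proof.
move=> lrm /=; have m0 : (0 < m)%N by lia.
by rewrite ltn_pmod // ltn_divLR // addnC -divn_eq.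
Qed.

(** The block number is the high digit of the index, its quotient by [m]. *)
Definition intervals : splitting_system :=
  SplittingSystem (cell := set R) shrink_inj shrink1 shrinkM shrink_root_inj
    interval_idx_lt interval_idxK interval_unidxP.
End IntervalSystem.

(** * Natural exact covering systems as abstract decompositions *)

(** The representative [a] may differ from [k]: with a = k + t m, the new classes are those built
    from [k] with indices shifted cyclically by [t] modulo [r], so their set is the same. *)
Lemma necs_step (C : {fset set int}) (a : int) (n r m k : nat) :
  (0 < n)%N -> (0 < r)%N -> (k < m)%N -> residue_class a n = @act residues m k root ->
  (C `\ residue_class a n) `|` [fset E i r a n | i in iota 0 r] =
  @split_cell residues C m k r.
Proof.
move=> n0 r0 km e; have m0 : (0 < m)%N by lia.
have ek : @act residues m k root = residue_class k%:Z m by exact: embed_root.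
have [nm] := residue_class_inj n0 m0 (etrans e ek); rewrite {}nm in e *.
rewrite {n n0} /split_cell e => /eqP.
rewrite eqz_mod_dvd => /dvdzP[t akt]; congr (_ `|` _).
have rz : r%:Z != 0 by lia.
have E_mod (i j : int) : (i + t = j %[mod r%:Z])%Z ->
    residue_class (i * m%:Z + a) (r * m) = residue_class (j * m%:Z + k%:Z) (r * m).
  move=> /eqP; rewrite eqz_mod_dvd => /dvdzP[q ij].
  apply: eq_residue_class; apply/eqP; rewrite eqz_mod_dvd; apply/dvdzP.
  by exists q; rewrite PoszM mulrA -ij -[a](subrK k%:Z) akt; ring.
have fE (j : nat) : @act residues m k (@act residues r j root) = E j r k%:Z m.
  by rewrite /= embed_root // embedE.
apply/fsetP => x; apply/imfsetP/imfsetP.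
  move=> [i _ ->]; pose j := `|((i%:Z + t) %% r%:Z)%Z|%N.
  have jE : j%:Z = ((i%:Z + t) %% r%:Z)%Z by rewrite gez0_abs // modz_ge0.
  exists (@act residues r j root).
    apply/fanP; exists j => //.
    by rewrite -ltz_nat jE ltz_mod.
  by rewrite fE; apply: E_mod; rewrite jE modz_mod.
move=> [y /fanP[j jr ->] ->]; rewrite fE.
(* The inverse cyclic shift. *)
pose i := `|((j%:Z - t) %% r%:Z)%Z|%N.
have iE : i%:Z = ((j%:Z - t) %% r%:Z)%Z by rewrite gez0_abs // modz_ge0.
exists i.
  by rewrite mem_iota /= add0n -ltz_nat iE ltz_mod.
by apply/esym/E_mod; rewrite iE modzDml subrK.
Qed.

Lemma necsP (C : {fset set int}) : necs C <-> @dec residues C.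
Proof.
split.
  elim=> [|{}C a n r _ dC n0 aC r2]; first exact: (@dec_root residues).
  have [m [k [km e]]] := dec_cells dC aC.
  rewrite (necs_step _ n0 _ km e); last by lia.
  by apply: dec_split => //; rewrite -e.
move=> /dec_refine; elim=> [|{}C m k r _ nC km mC r2]; first exact: necs1.
have m0 : (0 < m)%N by lia.
have e : residue_class k%:Z m = @act residues m k root.
  by rewrite /= embed_root.
rewrite -(necs_step _ m0 _ km e); last by lia.
by apply: necs_split => //; rewrite e.
Qed.

(** * Decompositions of (0,1), their gcd and blocks, and the map [Phi] *)

Section Intervals.
Variable R : realType.
Local Notation intervals := (intervals R).
Implicit Types (S : {fset set R}).

Lemma interval_step S (a b : R) (p m k : nat) :
  a < b -> (0 < p)%N -> (k < m)%N -> oo a b = @act intervals m k root ->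
  (S `\ oo a b) `|` H1 p a b = @split_cell intervals S m k p.
Proof.
move=> ab p0 km e; have m0 : (0 < m)%N by lia.
have pR : p%:R != 0 :> R by rewrite pnatr_eq0; lia.
have mR : m%:R != 0 :> R by rewrite pnatr_eq0; lia.
rewrite /split_cell e; congr (_ `|` _).
have [-> ->] : a = k%:R / m%:R /\ b = k.+1%:R / m%:R.
  by apply: oo_inj => //; rewrite e /= shrink_root.
have fE (j : nat) : @act intervals m k (@act intervals p j root) =
    oo (k%:R / m%:R + j%:R / p%:R * (k.+1%:R / m%:R - k%:R / m%:R))
       (k%:R / m%:R + j.+1%:R / p%:R * (k.+1%:R / m%:R - k%:R / m%:R)).
  rewrite /= shrink_root // shrink_oo //.
  by congr oo; rewrite -[k.+1%:R]natr1; field; rewrite pR mR.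
apply/fsetP => x; apply/imfsetP/imfsetP.
  move=> [j]; rewrite [in_mem _ _]mem_iota => jp ->.
  by exists (@act intervals p j root); [apply/fanP; exists j|rewrite fE].
move=> [y /fanP[j jp ->] ->]; exists j; last by rewrite fE.
by rewrite /= mem_iota.
Qed.

(** Every interval met along a refinement of [S0] is an orbit cell, so [interval_step] applies to
    each splitting. *)
Lemma refinesP (S0 S : {fset set R}) : @cells intervals S0 ->
  refines S0 S <-> @refine intervals S0 S.
Proof.
move=> cS0; split.
  elim=> [|{}S a b p _ rS ab aS p2]; first exact: refine_refl.
  have [m [k [km e]]] := cells_refine cS0 rS aS.
  rewrite (interval_step _ ab _ km e); last by lia.
  by apply: refine_split => //; rewrite -e.
elim=> [|{}S m k p _ rS km mS p2]; first exact: refines_refl.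
have m0 : (0 < m)%N by lia.
have ab : k%:R / m%:R < k.+1%:R / m%:R :> R.
  by rewrite ltr_pM2r ?invr_gt0 ?ltr0n // ltr_nat.
have e : oo (k%:R / m%:R) (k.+1%:R / m%:R) = @act intervals m k root.
  by rewrite /= shrink_root.
rewrite -(interval_step _ ab _ km e); last by lia.
by apply: refines_split => //; rewrite e.
Qed.

Lemma decompositionP S : decomposition S <-> @dec intervals S.
Proof.
rewrite /decomposition refinesP; last exact: (@cells_root intervals).
by rewrite (@dec_refine intervals).
Qed.

Lemma D_fan (r : nat) : D R r = @fan intervals r.
Proof.
apply/fsetP => x; apply/imfsetP/(@fanP intervals) => -[j].
  rewrite [in_mem _ _]mem_iota => jr ->; exists j => //.
  by rewrite /= shrink_root //; lia.
by move=> jr ->; exists j; [rewrite /= mem_iota|rewrite /= shrink_root //; lia].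
Qed.

(** Both conditions amount to being glued from [r] decompositions. *)
Lemma refines_D (r : nat) S : (0 < r)%N -> @dec intervals S ->
  refines (D R r) S <-> @moduli_div intervals r S.
Proof.
move=> r0 dS; rewrite D_fan refinesP; last exact: (@cells_fan intervals).
by rewrite (@moduli_div_dec intervals) // (@refine_fanP intervals).
Qed.

(** [xget] returns some witness or the default 0; here a witness exists and maximality makes it
    unique. *)
Lemma gcdS_moduli (r : nat) S : (0 < r)%N -> @dec intervals S ->
  @moduli_gcd intervals r S -> gcdS S = r.
Proof.
move=> r0 dS gr; apply: xget_unique => [|r' [r'0 dr' mr']].
  have [dr mr] := gr; split=> //; first exact/refines_D.
  by move=> r' rr' /refines_D h; apply: (mr r' rr'); apply: h => //; lia.
apply/esym/(moduli_gcd_uniq gr); split; first exact/refines_D.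
by move=> q r'q dq; apply: (mr' q r'q); apply/refines_D => //; lia.
Qed.

(** A cell of block [i] has positive length and lies in (i/r, (i+1)/r), so the containment test of
    [block] selects exactly i = j; scaling then undoes [shrink]. *)
Lemma block_glue (r j : nat) (F : nat -> {fset set R}) : (j < r)%N ->
  (forall i, (i < r)%N -> @cells intervals (F i)) ->
  block (@glue intervals r F) r j = F j.
Proof.
move=> jr cF; have r0 : (0 < r)%N by lia.
have rR : r%:R != 0 :> R by rewrite pnatr_eq0; lia.
have unshrink (I : set R) : [set r%:R * x - j%:R | x in shrink r j I]%classic = I.
  rewrite image_comp -[RHS]image_id; apply: eq_imagel => x _ /=.
  by field.
have in_block (i : nat) (I : set R) : (i < r)%N -> @is_cell intervals I ->
    `[< (shrink r i I `<=` oo (j%:R / r%:R) (j.+1%:R / r%:R))%classic >] = (i == j).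
  move=> ir [m [k [km ->]]].
  have m0 : (0 < m)%N by lia.
  rewrite [act _ _ _]/= shrink_root // shrink_oo //.
  have mR : 0 < m%:R :> R by rewrite ltr0n.
  have rR0 : 0 < r%:R :> R by rewrite ltr0n.
  have ab : k%:R / m%:R < k.+1%:R / m%:R :> R.
    by rewrite ltr_pM2r ?invr_gt0 // ltr_nat.
  have a0 : 0 <= k%:R / m%:R :> R by rewrite divr_ge0.
  have b1 : k.+1%:R / m%:R <= 1 :> R by rewrite ler_pdivrMr // mul1r ler_nat.
  apply/asboolP/eqP => [|->].
    move=> /oo_sub[]; first by rewrite ltr_pM2r ?invr_gt0 // ltrD2r.
    rewrite !ler_pM2r ?invr_gt0 // => ja bj.
    (* Nondegeneracy of the cell gives j < i + 1 and i < j + 1, whence i = j. *)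
    have ji : j%:R < i.+1%:R :> R by rewrite -natr1; lra.
    have ij : i%:R < j.+1%:R :> R by lra.
    by move: ji ij; rewrite !ltr_nat; lia.
  apply: subset_itvW; rewrite ler_pM2r ?invr_gt0 //; first by lra.
  by rewrite -natr1; lra.
apply/fsetP => x; apply/imfsetP/idP => [[I /=]|xF].
  rewrite inE => /andP[/(@glueP intervals)[i [y [ir yF ->]]]].
  rewrite /= in_block //; last exact: (cF i).
  by move=> /eqP ij ->; rewrite ij in yF *; rewrite unshrink.
exists (shrink r j x); last by rewrite unshrink.
rewrite inE /= in_block ?eqxx ?andbT //; last exact: (cF j).
by apply/(@glueP intervals); exists j, x.
Qed.

(** The recursion follows the normal form: [gcdS] returns its [r] and [block] its blocks. *)
Lemma corr_Phi_rec (k : nat) S : @dec intervals S -> (#|` S| <= k)%N ->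
  @corr intervals residues S (Phi_rec k S).
Proof.
(* Zero fuel cannot occur, as a decomposition is nonempty. *)
elim: k S => [|k IH] S dS Sk; first by have := leq_trans (dec_gt0 dS) Sk.
rewrite /=; case: ifPn => S2.
  by rewrite (dec_card1 dS S2); exact: (@corr_root intervals residues).
rewrite -ltnNge in S2; have [r [F [r2 dF gr SE]]] := dec_normal dS S2.
rewrite (gcdS_moduli _ dS gr); last by lia.
rewrite SE in gr Sk *.
apply: (@corr_glue intervals residues) => // j jr.
rewrite block_glue // => [|i /dF/dec_cells//].
apply: IH; first exact: dF.
by rewrite -ltnS; exact: leq_trans (card_glue_lt r2 dF jr) Sk.
Qed.

End Intervals.

Theorem proposition18 (R : realType) (n : nat) (hn : (1 <= n)%N) :
  set_bij [set S : {fset set R} | decomposition S /\ #|` S| = n]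
          [set C : {fset set int} | necs C /\ #|` C| = n]
          (@Phi R).
Proof.
(* The relation is oriented from classes to intervals, so that [corr_fun] yields injectivity. *)
have PhiP (S : {fset set R}) : decomposition S ->
    @corr residues (intervals R) (Phi S) S.
  by move=> /decompositionP dS; apply/corr_sym/corr_Phi_rec.
split.
- move=> S [/PhiP dS <-]; split; first exact/necsP/(corr_decl dS).
  exact: corr_card dS.
- move=> S S'; rewrite !inE => -[/PhiP dS _] [/PhiP dS' _] e.
  by rewrite e in dS; exact: corr_fun dS dS'.
(* Totality from the side of classes supplies the preimage; functionality from the side of intervals
   identifies its image with [C]. *)
- move=> C [/necsP/(@corr_total residues (intervals R))[S CS] <-].
  have dS := corr_decr CS; exists S.
    by split; [exact/decompositionP|rewrite -(corr_card CS)].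
  exact: corr_fun (corr_sym (PhiP S ((decompositionP S).2 dS))) (corr_sym CS).
Qed.
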